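(* Let $(S,\mathcal{A},\nu)$ be a $\sigma$-finite measure space. Let $\mathfrak{F}$ be a family of measurable functions from $S$ into $(-\infty,\infty]$ such that $$\int f^-\,d\nu<\infty\quad\text{for each } f\in\mathfrak{F}.$$ Let $(f_j)_{j\in\mathbb{N}}$ be a sequence in $\mathfrak{F}$. Define $\check f=\sup_{j\ge1}f_j$ and assume that $\sup_{f\in\mathfrak{F}}f=\check f$ (pointwise suprema). For each $f\in\mathfrak{F}$ let $\mu_f$ be the signed measure defined by $$\mu_f(A)=\int_A f\,d\nu,\qquad A\in\mathcal{A}.$$ If we define $\check\mu:=\sup_{f\in\mathfrak{F}}\mu_f$, then $\check\mu=\sup_{j\ge1}\mu_{f_j}$ and $$\check\mu(A)=\int_A\check f\,d\nu,\qquad A\in\mathcal{A}.$$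
   Context: Here $f^-=\max\{-f,0\}$. For a family $(\mu_i)_{i\in I}$ of signed measures on $\mathcal{A}$ with $\sup_{i}\mu_i(A)>-\infty$ for all $A\in\mathcal{A}$, the supremum $\sup_{i\in I}\mu_i$ denotes the set function $$\Bigl(\sup_{i\in I}\mu_i\Bigr)(A):=\sup_{\Pi\in\mathscr{P}(A)}\sum_{C\in\Pi}\sup_{i\in I}\mu_i(C),\qquad A\in\mathcal{A},$$ where $\mathscr{P}(A)$ is the family of all finite partitions of $A$ by elements of $\mathcal{A}$; it is the least upper bound of the family, for the pointwise order on $\mathcal{A}$, among signed charges (finitely additive set functions $\mathcal{A}\to[-\infty,\infty]$ vanishing at $\emptyset$ and avoiding at least one of the values $\pm\infty$). A signed measure is a countably additive signed charge. *)

(* Defs.v *)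
From HB Require Import structures.
From mathcomp Require Import all_boot all_order all_algebra.
From mathcomp Require Import all_classical all_reals all_analysis.
From mathcomp Require Import measurable_realfun.

Set Implicit Arguments.
Unset Strict Implicit.
Unset Printing Implicit Defensive.

Import Order.TTheory GRing.Theory Num.Theory.
Import numFieldNormedType.Exports.

Local Open Scope classical_set_scope.
Local Open Scope ring_scope.
Local Open Scope ereal_scope.

Section signed_measures.
Context (d : measure_display) (S : measurableType d) (R : realType).

(* Set functions are total on [set S]; only their values on measurable sets
   matter.  Unlike the library's [charge], a signed charge may take one of the
   values +oo and -oo. *)
Definition signed_charge (mu : set S -> \bar R) : Prop :=
  [/\ mu set0 = 0,
      additive2 mu &
      (forall A, measurable A -> mu A != -oo) \/
      (forall A, measurable A -> mu A != +oo)].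

Definition signed_measure (mu : set S -> \bar R) : Prop :=
  signed_charge mu /\ sigma_additive mu.

(* The families whose supremum is defined below; the index set is [D]. *)
Definition sup_admissible (I : Type) (D : set I) (mu : I -> set S -> \bar R)
    : Prop :=
  (forall i, D i -> signed_measure (mu i)) /\
  (forall A, measurable A -> -oo < ereal_sup [set mu i A | i in D]).

(* Blocks are nonempty, which is immaterial since mu set0 = 0. *)
Definition finite_measurable_partition (A : set S) (P : set (set S)) : Prop :=
  [/\ finite_set P, P `<=` measurable & partition P id A].

Definition sup_signed_measure (I : Type) (D : set I)
    (mu : I -> set S -> \bar R) (A : set S) : \bar R :=
  ereal_sup [set \sum_(C \in P) ereal_sup [set mu i C | i in D]
            | P in finite_measurable_partition A].

Definition integral_charge (nu : {measure set S -> \bar R})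
    (f : S -> \bar R) (A : set S) : \bar R :=
  \int[nu]_(x in A) f x.

End signed_measures.

Definition pointwise_sup (R : realType) (S I : Type) (D : set I)
    (f : I -> S -> \bar R) (x : S) : \bar R :=
  ereal_sup [set f i x | i in D].

(* Main.v *)
Require Import Defs.
From HB Require Import structures.
From mathcomp Require Import all_boot all_order all_algebra.
From mathcomp Require Import all_classical all_reals all_analysis.
From mathcomp Require Import measurable_realfun.

Set Implicit Arguments.
Unset Strict Implicit.
Unset Printing Implicit Defensive.

Import Order.TTheory GRing.Theory Num.Theory.
Import numFieldNormedType.Exports.

Local Open Scope classical_set_scope.
Local Open Scope ring_scope.
Local Open Scope ereal_scope.

(** Write [h] for the pointwise supremum of the sequence.

    The bound by [\int_A h] is soft: on each block [C] of a finite partition of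
    [A], every member of the family has integral at most [\int_C h]
    ([le_integral_measurable]), and the numbers [\int_C h] add up to [\int_A h]
    ([integral_partition]).  Hence [sup_integral_charge_le], for the whole
    family as well as for the sequence.

    For the converse it is enough to use the sequence.  The running maximum
    [g n] of [f 0, ..., f n] is a measurable selection: [g n x = f (a x) x] with
    [a x] an index, at most [n], that depends measurably on [x].  The level sets
    of [a] split [A] into finitely many blocks on each of which [g n] is one of
    the [f j], so [\int_A g n] is at most one of the sums over partitions whose
    supremum is the supremum of the charges ([integral_selection_le]).  Finally
    [g n] increases to [h], and [\int_A g n] to [\int_A h]; adding the
    integrable function [(g 0)^\-] reduces this to monotone convergence for
    nonnegative functions ([integral_ereal_sup_le]).

    Since the sequence lies in the family, its supremum is squeezed together
    with that of the family: both equal [\int_A h]. *)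

(** * Integrals of extended real functions *)

Section integral_set_function.
Context (d : measure_display) (S : measurableType d) (R : realType).

Lemma measurable_pointwise_sup (D : set S) (f : nat -> S -> \bar R) :
    (forall n, measurable_fun D (f n)) ->
  measurable_fun D (pointwise_sup setT f).
Proof.
move=> mf; have := measurable_fun_esups mf 0; congr measurable_fun.
apply/funext => x; congr ereal_sup.
by apply/seteqP; split => _ [n _ <-]; exists n.
Qed.

Context (nu : {measure set S -> \bar R}).

(** Monotonicity survives without any integrability: positive parts increase,
    negative parts decrease, and subtraction on [\bar R] is monotone even at
    [+oo - +oo], which is [-oo]. *)
Lemma le_integral_measurable (A : set S) (f h : S -> \bar R) :
    measurable A -> measurable_fun A f -> measurable_fun A h ->
    (forall x, A x -> f x <= h x) ->
  \int[nu]_(x in A) f x <= \int[nu]_(x in A) h x.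
Proof.
move=> mA mf mh fh; rewrite [leLHS]integralE [leRHS]integralE.
have fh' : {in A, forall x, f x <= h x} by move=> x; rewrite inE => /fh.
apply: leeB; apply: ge0_le_integral => //.
- exact: measurable_funepos.
- exact: measurable_funepos.
- by move=> x Ax; apply: (funepos_le fh'); rewrite inE.
- exact: measurable_funeneg.
- exact: measurable_funeneg.
- by move=> x Ax; apply: (funeneg_le fh'); rewrite inE.
Qed.

Lemma integral_partition (h : S -> \bar R) (A : set S) (P : set (set S)) :
    measurable_fun setT h -> finite_measurable_partition A P ->
  \sum_(C \in P) \int[nu]_(x in C) h x = \int[nu]_(x in A) h x.
Proof.
move=> mh [finP mP [<- trP _]]; rewrite fsbig_finite//= /cover.
have mh' B : measurable B -> measurable_fun B h.
  by move=> mB; exact: measurable_funS mh.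
rewrite -[in RHS](fset_setK finP) bigcup_seq.
move: (finmap.fset_uniq (fset_set P)).
have : {subset finmap.enum_fset (fset_set P) <= P}.
  by move=> C; rewrite in_fset_set.
elim: (finmap.enum_fset (fset_set P)) => [|C s ih] sP /=.
  by rewrite !big_nil integral_set0.
move=> /andP[Cs us].
have CP : P C by apply/set_mem/sP; rewrite inE eqxx.
have sP' : {subset s <= P} by move=> B Bs; apply: sP; rewrite inE Bs orbT.
have mC := mP _ CP.
have mU : measurable (\big[setU/set0]_(B <- s) B).
  rewrite -bigcup_seq; apply: fin_bigcup_measurable => // B /=.
  by move=> /sP'/set_mem/mP.
rewrite !big_cons integral_setU ?ih//; first exact/mh'/measurableU.
apply/disj_setPS => x [Cx]; rewrite -bigcup_seq => -[B /= Bs Bx].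
move: Cs; rewrite (_ : C = B) ?Bs//.
by apply: trP => //; [exact/set_mem/sP'|exists x].
Qed.

Section integrable_negative_part.
Context (f : S -> \bar R) (mf : measurable_fun setT f)
  (fneg : \int[nu]_x f^\- x < +oo).

Lemma integral_funeneg_fin_num A : measurable A ->
  \int[nu]_(x in A) f^\- x \is a fin_num.
Proof.
move=> mA; rewrite ge0_fin_numE ?integral_ge0//.
apply: le_lt_trans fneg; apply: ge0_subset_integral => //.
exact: measurable_funeneg.
Qed.

Lemma integral_charge_gtNy A : measurable A -> -oo < integral_charge nu f A.
Proof.
move=> mA; rewrite /integral_charge integralE.
apply: (@lt_le_trans _ _ (0 - \int[nu]_(x in A) f^\- x)).
  by rewrite sub0e lteNr/= ltey_eq integral_funeneg_fin_num.
by rewrite leeD2r// integral_ge0.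
Qed.

(** Split [f] into its positive and negative parts: both indefinite integrals
    are measures, and the second one is finite, so that partial sums and limits
    may be subtracted. *)
Lemma signed_measure_integral : signed_measure (integral_charge nu f).
Proof.
rewrite /integral_charge; split; first split.
- exact: integral_set0.
- move=> A B mA mB AB0; apply: integral_setU => //.
    by apply: measurable_funS mf => //; exact: measurableU.
  by apply/eqP.
- by left=> A mA; rewrite -ltNye; exact: integral_charge_gtNy.
move=> F mF tF; have mU : measurable (\bigcup_n F n) by exact: bigcupT_measurable.
have sumE n : \sum_(0 <= i < n) \int[nu]_(x in F i) f x =
    \sum_(0 <= i < n) \int[nu]_(x in F i) f^\+ x -
    \sum_(0 <= i < n) \int[nu]_(x in F i) f^\- x.
  under eq_bigr do rewrite integralE.
  rewrite big_split/= fin_num_sumeN// => i _.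
  exact: integral_funeneg_fin_num.
under eq_cvg do rewrite sumE.
rewrite integralE; apply: cvgeB.
- by rewrite fin_num_adde_defl// fin_numN integral_funeneg_fin_num.
- rewrite ge0_integral_bigcup//.
    by apply: is_cvg_nneseries => n _ _; exact: integral_ge0.
  by apply: (measurable_funS measurableT) => //; exact: measurable_funepos.
- rewrite ge0_integral_bigcup//.
    by apply: is_cvg_nneseries => n _ _; exact: integral_ge0.
  by apply: (measurable_funS measurableT) => //; exact: measurable_funeneg.
Qed.

End integrable_negative_part.

(** Here [h] need not be integrable, but [h^\- <= k] because [0 <= h + k].  So
    [h^\+ + k = (h + k) + h^\-] is an identity between nonnegative functions;
    integrate it and subtract the finite integral of [h^\-]. *)
Lemma integral_shift (A : set S) (h k : S -> \bar R) : measurable A ->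
    measurable_fun A h -> measurable_fun A k ->
    (forall x, A x -> 0 <= k x < +oo) -> \int[nu]_(x in A) k x < +oo ->
    (forall x, A x -> 0 <= h x + k x) ->
  \int[nu]_(x in A) (h x + k x) = \int[nu]_(x in A) h x + \int[nu]_(x in A) k x.
Proof.
move=> mA mh mk k0 kfin hk0.
have k0' x : A x -> 0 <= k x by move=> /k0/andP[].
have kfn : \int[nu]_(x in A) k x \is a fin_num.
  by rewrite ge0_fin_numE ?integral_ge0.
have mhp := measurable_funepos mh; have mhn := measurable_funeneg mh.
have hnk x : A x -> h^\- x <= k x.
  move=> Ax; rewrite funenegE ge_max k0'// andbT.
  have /andP[kx0 kxy] := k0 _ Ax.
  by move: (hk0 _ Ax); rewrite -leeBlDr ?ge0_fin_numE// sub0e leeNl.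
have hnfn : \int[nu]_(x in A) h^\- x \is a fin_num.
  rewrite ge0_fin_numE ?integral_ge0//; apply: le_lt_trans kfin.
  exact: ge0_le_integral.
have mhk : measurable_fun A (fun x => h x + k x) by exact: emeasurable_funD.
have : \int[nu]_(x in A) h^\+ x + \int[nu]_(x in A) k x =
    \int[nu]_(x in A) (h x + k x) + \int[nu]_(x in A) h^\- x.
  rewrite -!ge0_integralD//; apply: eq_integral => x; rewrite inE => Ax.
  rewrite addeAC; congr (_ + _).
  have hnx : h^\- x \is a fin_num.
    rewrite ge0_fin_numE//; apply: le_lt_trans (hnk _ Ax) _.
    by have /andP[] := k0 _ Ax.
  have hE : h x = h^\+ x - h^\- x by rewrite {1}(funeposneg h).
  by rewrite hE subeK.
move=> E; rewrite [X in _ = X + _]integralE addeAC E addeK//.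
Qed.

(** The functions [g n + (g 0)^\-] are nonnegative and increasing, so monotone
    convergence applies to them, and [integral_shift] removes the shift. *)
Lemma integral_ereal_sup_le (A : set S) (g : nat -> S -> \bar R) :
    measurable A -> (forall n, measurable_fun setT (g n)) ->
    (forall x, {homo g^~ x : m n / (m <= n)%N >-> m <= n}) ->
    (forall x, -oo < g 0%N x) -> \int[nu]_x (g 0%N)^\- x < +oo ->
  \int[nu]_(x in A) ereal_sup (range (g^~ x)) <=
  ereal_sup (range (fun n => \int[nu]_(x in A) g n x)).
Proof.
move=> mA mg ndg g0Ny g0fin; set k := (g 0%N)^\-.
have mgA n : measurable_fun A (g n) by exact: measurable_funS (mg n).
have mk : measurable_fun A k by exact: measurable_funeneg.
have k0 x : 0 <= k x < +oo.
  by rewrite funeneg_ge0/= /k funenegE gt_max ltry andbT lteNl.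
have kfin x : k x \is a fin_num by have /andP[? ?] := k0 x; rewrite ge0_fin_numE.
have Ik : \int[nu]_(x in A) k x \is a fin_num by exact: integral_funeneg_fin_num.
have Ik' : \int[nu]_(x in A) k x < +oo by rewrite ltey_eq Ik.
have gk0 n x : 0 <= g n x + k x.
  rewrite -leeBlDr// sub0e; apply: le_trans (ndg x 0%N n _) => //.
  by rewrite leeNl /k funenegE le_max lexx.
have gcvg x : g n x @[n --> \oo] --> ereal_sup (range (g^~ x)).
  by apply: ereal_nondecreasing_cvgn => m n; exact: ndg.
have limE x : limn (fun n => g n x + k x) = ereal_sup (range (g^~ x)) + k x.
  apply/cvg_lim => //; apply: cvgeD => //; first exact: fin_num_adde_defl.
  exact: cvg_cst.
have ms := measurable_pointwise_sup mgA.
have ndgk x : A x ->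
    {homo (fun n => g n x + k x) : m n / (m <= n)%N >-> m <= n}.
  by move=> _ m n mn; rewrite leeD2r// ndg.
have mgk n : measurable_fun A (fun x => g n x + k x) by exact: emeasurable_funD.
rewrite -(leeD2rE _ _ Ik) -integral_shift//; last first.
  move=> x _; apply: le_trans (gk0 0%N x) _; rewrite leeD2r//.
  by apply: ereal_sup_ubound; exists 0%N.
under eq_integral do rewrite -limE.
have cvgI := @cvg_monotone_convergence _ _ _ nu A mA
  (fun n x => g n x + k x) mgk (fun n x _ => gk0 n x) ndgk.
rewrite -(cvg_lim _ cvgI)//; apply: lime_le.
  by apply/cvg_ex; eexists; exact: cvgI.
apply: nearW => n; rewrite integral_shift// leeD2r//.
by apply: ereal_sup_ubound; exists n.
Qed.

End integral_set_function.

(** * Suprema of families of integral charges *)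

Section supremum_of_charges.
Context (d : measure_display) (S : measurableType d) (R : realType).

Lemma sup_signed_measure_ge (I : Type) (D : set I) (mu : I -> set S -> \bar R)
    (A : set S) (P : set (set S)) (a : set S -> \bar R) :
    finite_measurable_partition A P ->
    (forall C, P C -> exists2 i, D i & a C <= mu i C) ->
  \sum_(C \in P) a C <= sup_signed_measure D mu A.
Proof.
move=> AP a_le.
apply: (@le_trans _ _ (\sum_(C \in P) ereal_sup [set mu i C | i in D])).
  have [finP _ _] := AP; apply: lee_fsum => // C PC.
  have [i Di /le_trans] := a_le _ PC; apply; apply: ereal_sup_ubound.
  by exists i.
by apply: ereal_sup_ubound; exists P.
Qed.

Context (nu : {measure set S -> \bar R}).

Lemma sup_integral_charge_le (I : Type) (D : set I) (f : I -> S -> \bar R)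
    (h : S -> \bar R) (A : set S) :
    measurable_fun setT h -> (forall i, D i -> measurable_fun setT (f i)) ->
    (forall i x, D i -> f i x <= h x) ->
  sup_signed_measure D (fun i => integral_charge nu (f i)) A <=
  \int[nu]_(x in A) h x.
Proof.
move=> mh mf fh; apply: ge_ereal_sup => _ [P AP <-].
rewrite -(integral_partition nu mh AP); have [finP mP _] := AP.
apply: lee_fsum => // C PC; apply: ge_ereal_sup => _ [i Di <-].
have mC := mP _ PC; apply: le_integral_measurable => //.
- exact: measurable_funS (mf _ Di).
- exact: measurable_funS mh.
- by move=> x _; exact: fh.
Qed.

(** The nonempty level sets of [a] in [A] form a finite measurable partition,
    and on the level set of [j] the integrand is [f j]. *)
Lemma integral_selection_le (f : nat -> S -> \bar R) (a : S -> nat) (n : nat)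
    (A : set S) :
    measurable A -> measurable_fun setT a -> (forall x, (a x <= n)%N) ->
    measurable_fun setT (fun x => f (a x) x) ->
  \int[nu]_(x in A) f (a x) x <=
  sup_signed_measure setT (fun j => integral_charge nu (f j)) A.
Proof.
move=> mA ma an mfa; pose B j := A `&` a @^-1` [set j].
pose P := [set B j | j in `I_n.+1] `\ set0.
have AP : finite_measurable_partition A P.
  split; first by apply: finite_setD; apply: finite_image; exact: finite_II.
    move=> _ [[j _ <-] _]; apply: measurableI => //.
    by rewrite -[X in measurable X]setTI; exact: ma.
  split.
  - apply/seteqP; split => [x [_ [[j _ <-] _] []]//|x Ax].
    have Bx : B (a x) x by [].
    exists (B (a x)) => //; split; first by exists (a x) => //=; rewrite ltnS.
    by move=> /= B0; move: Bx; rewrite B0.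
  - by move=> _ _ [[i _ <-] _] [[j _ <-] _] [x [[_ <-] [_ <-]]].
  - by move=> C [_ /eqP/set0P].
rewrite -(integral_partition nu mfa AP); apply: sup_signed_measure_ge => // C.
move=> [[j _ <-] _]; exists j => //; rewrite /integral_charge.
by rewrite (@eq_integral _ _ _ nu _ (f j))// => x; rewrite inE => -[_ /= ->].
Qed.

End supremum_of_charges.

(** * The running maximum of a sequence *)

Section running_maximum.
Context (d : measure_display) (S : measurableType d) (R : realType).
Context (f : nat -> S -> \bar R).

(** The strict inequality selects the first index where the maximum is attained,
    and the recursion makes the choice visibly measurable. *)
Fixpoint argmax_upto (n : nat) (x : S) : nat :=
  if n is m.+1 then
    if f (argmax_upto m x) x < f m.+1 x then m.+1 else argmax_upto m x
  else 0%N.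

(** Defined through the index, so that the maximum is a selection from the
    sequence by construction; [max_uptoS] recovers the usual recursion. *)
Definition max_upto (n : nat) (x : S) : \bar R := f (argmax_upto n x) x.

Lemma max_uptoS n x : max_upto n.+1 x = maxe (max_upto n x) (f n.+1 x).
Proof. by rewrite /max_upto /= /maxe; case: ifP. Qed.

Lemma argmax_upto_le n x : (argmax_upto n x <= n)%N.
Proof. by elim: n => //= n ih; case: ifP => // _; exact: leqW. Qed.

Lemma nondecreasing_max_upto x :
  {homo max_upto^~ x : m n / (m <= n)%N >-> m <= n}.
Proof.
by apply: homo_leq => [?|? ? ?|n] /=; [exact: lexx|exact: le_trans|];
  rewrite max_uptoS le_max lexx.
Qed.

Lemma le_max_upto n x : f n x <= max_upto n x.
Proof. by case: n => [|n]; rewrite ?max_uptoS ?le_max lexx ?orbT. Qed.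

Context (mf : forall n, measurable_fun setT (f n)).

Lemma measurable_max_upto n : measurable_fun setT (max_upto n).
Proof.
elim: n => [|n ih]; first exact: mf.
rewrite (funext (max_uptoS n)).
exact: measurable_maxe.
Qed.

Lemma measurable_argmax_upto n : measurable_fun setT (argmax_upto n).
Proof.
elim: n => [|n ih] /=; first exact: measurable_cst.
apply: measurable_fun_ifT => //.
exact: (measurable_fun_lte (measurable_max_upto n) (mf n.+1)).
Qed.

(** The running maxima increase to the supremum of the sequence, and each of
    them is a selection from it. *)
Lemma integral_pointwise_sup_le (nu : {measure set S -> \bar R}) (A : set S) :
    measurable A -> (forall x, -oo < f 0%N x) -> \int[nu]_x (f 0%N)^\- x < +oo ->
  \int[nu]_(x in A) pointwise_sup setT f x <=
  sup_signed_measure setT (fun j => integral_charge nu (f j)) A.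
Proof.
move=> mA f0Ny f0neg.
have supE x : pointwise_sup setT f x = ereal_sup (range (max_upto^~ x)).
  apply/eqP; rewrite eq_le; apply/andP; split.
    apply: ge_ereal_sup => _ [n _ <-]; apply: le_trans (le_max_upto n x) _.
    by apply: ereal_sup_ubound; exists n.
  apply: ge_ereal_sup => _ [n _ <-].
  by apply: ereal_sup_ubound; exists (argmax_upto n x).
under eq_integral do rewrite supE.
apply: le_trans (integral_ereal_sup_le mA measurable_max_upto
  nondecreasing_max_upto f0Ny f0neg) _.
apply: ge_ereal_sup => _ [n _ <-].
apply: (@integral_selection_le _ _ _ _ _ (argmax_upto n) n) => //.
- exact: measurable_argmax_upto.
- exact: argmax_upto_le.
- exact: measurable_max_upto.
Qed.

End running_maximum.

Theorem theorem8p1 (d : measure_display) (S : measurableType d) (R : realType)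
    (nu : {sigma_finite_measure set S -> \bar R})
    (F : set (S -> \bar R))
    (F_measurable : forall f, F f -> measurable_fun setT f)
    (F_gtNy : forall f, F f -> forall x, -oo < f x)
    (F_neg : forall f, F f -> \int[nu]_x (f^\- x) < +oo)
    (f_ : nat -> S -> \bar R)
    (f_F : forall j, F (f_ j))
    (sup_F : pointwise_sup F id = pointwise_sup setT f_) :
  let mu := integral_charge nu in
  let mu_check := sup_signed_measure F mu in
  [/\ sup_admissible F mu,
      sup_admissible setT (fun j => mu (f_ j)),
      forall A, measurable A ->
        mu_check A = sup_signed_measure setT (fun j => mu (f_ j)) A &
      forall A, measurable A ->
        mu_check A = \int[nu]_(x in A) pointwise_sup setT f_ x].
Proof.
move=> mu mu_check.
have m_sup : measurable_fun setT (pointwise_sup setT f_).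
  by apply: measurable_pointwise_sup => j; exact: F_measurable.
have f_sup f x : F f -> f x <= pointwise_sup setT f_ x.
  by move=> Ff; rewrite -sup_F; apply: ereal_sup_ubound; exists f.
have mu_f_gtNy A : measurable A -> -oo < mu (f_ 0%N) A.
  move=> mA; apply: integral_charge_gtNy => //.
    exact: F_measurable.
  exact: F_neg.
have seqE A : measurable A ->
    sup_signed_measure setT (fun j => mu (f_ j)) A =
    \int[nu]_(x in A) pointwise_sup setT f_ x.
  move=> mA; apply/eqP; rewrite eq_le; apply/andP; split.
    apply: sup_integral_charge_le => // j; first by move=> _; exact: F_measurable.
    by move=> x _; exact: f_sup.
  apply: integral_pointwise_sup_le => //; [|exact: F_gtNy|exact: F_neg].
  by move=> j; exact: F_measurable.
have famE A : measurable A ->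
    mu_check A = \int[nu]_(x in A) pointwise_sup setT f_ x.
  move=> mA; apply/eqP; rewrite eq_le; apply/andP; split.
    by apply: sup_integral_charge_le => // f x Ff; exact: f_sup.
  (* For each partition, the sum for the whole family dominates. *)
  rewrite -seqE//; apply: ge_ereal_sup => _ [P AP <-].
  apply: le_trans (_ : \sum_(C \in P) ereal_sup [set mu f C | f in F] <= _).
    have [finP _ _] := AP; apply: lee_fsum => // C PC.
    by apply: ereal_sup_le => _ [j _ <-]; exists (f_ j).
  by apply: ereal_sup_ubound; exists P.
split=> //.
- split=> [f Ff|A mA].
    by apply: signed_measure_integral; [exact: F_measurable|exact: F_neg].
  by apply: lt_le_trans (mu_f_gtNy A mA) _; apply: ereal_sup_ubound; exists (f_ 0%N).
- split=> [j _|A mA].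
    by apply: signed_measure_integral; [exact: F_measurable|exact: F_neg].
  by apply: lt_le_trans (mu_f_gtNy A mA) _; apply: ereal_sup_ubound; exists 0%N.
- by move=> A mA; rewrite seqE// famE.
Qed.
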